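(* Let $k,l\ge 1$, $n=k+l$, and let $$H=\begin{pmatrix} A & B\\ B^\star & C\end{pmatrix}\in M_n(\mathbb{C}),\qquad A\in M_k(\mathbb{C}),\ C\in M_l(\mathbb{C}),$$ be Hermitian and positive semidefinite. If $H$ is of maximal rank, then $${\det}_+ H\le {\det}_+ A\;\,{\det}_+ C,$$ with equality if and only if $B=0$.
   Context: $B^\star$ denotes the conjugate transpose of $B$; $N(M)$ and $R(M)$ denote the nullspace and range of a matrix $M$. Maximal rank: the positive semidefinite Hermitian matrix $H=\begin{pmatrix} A & B\\ B^\star & C\end{pmatrix}$ is of maximal rank (with respect to this partition) if $N(H)=N(A)\oplus N(C)$; equivalently, $\operatorname{rank}H=\operatorname{rank}A+\operatorname{rank}C$. Generalized determinant: for a nonzero Hermitian matrix $M$, ${\det}_+ M$ is the determinant of the linear map $M|_{R(M)}:R(M)\to R(M)$; for $M=0$, ${\det}_+ M=1$. *)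

(* Defs.v *)
From HB Require Import structures.
From mathcomp Require Import all_boot all_order all_algebra.
From mathcomp Require Export reals complex.

Set Implicit Arguments.
Unset Strict Implicit.
Unset Printing Implicit Defensive.

Import Order.TTheory GRing.Theory Num.Theory passmx.
Local Open Scope ring_scope.
Local Open Scope sesquilinear_scope.

Section LinearMaps.
Variable F : fieldType.

(* Matrices act on column vectors by left multiplication. *)
Definition mxlfun m n (M : 'M[F]_(m, n)) : 'Hom('cV[F]_n, 'cV[F]_m) :=
  linfun (mulmx M).

Definition nullspace m n (M : 'M[F]_(m, n)) : {vspace 'cV[F]_n} :=
  lker (mxlfun M).

Definition rangespace m n (M : 'M[F]_(m, n)) : {vspace 'cV[F]_m} :=
  limg (mxlfun M).

(* [mxof] uses the row-vector convention, so this is the transpose of the usual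
   matrix of [f]; the determinant is unaffected. *)
Definition lfun_det (vT : vectType F) (f : 'End(vT)) : F :=
  \det (mxof (vbasis {:vT}) (vbasis {:vT}) f).

(* The endomorphism M|_{R(M)} of R(M); as M maps into R(M), the projection
   [vsproj] only changes the codomain. *)
Definition range_restr n (M : 'M[F]_n) : 'End(subvs_of (rangespace M)) :=
  linfun (fun u => vsproj (rangespace M) (mxlfun M (vsval u))).

(* For M = 0 this is the determinant of an endomorphism of the zero space,
   i.e. 1 (see [det_plus0]). *)
Definition det_plus n (M : 'M[F]_n) : F := lfun_det (range_restr M).

(* N(H) = N(A) (+) N(C), where A and C are the diagonal blocks of H and F^k,
   F^l are embedded in F^(k + l) as the first and last coordinates; the sum is
   direct since the two embedded spaces only meet in 0. *)
Definition maximal_rank k l (H : 'M[F]_(k + l)) : Prop :=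
  nullspace H =
    (mxlfun (col_mx 1%:M 0) @: nullspace (ulsubmx H)
     + mxlfun (col_mx 0 1%:M) @: nullspace (drsubmx H))%VS.

Lemma mem_nullspace m n (M : 'M[F]_(m, n)) x :
  (x \in nullspace M) = (M *m x == 0).
Proof. by rewrite memv_ker lfunE. Qed.

Lemma mem_rangespace m n (M : 'M[F]_(m, n)) y :
  reflect (exists x, y = M *m x) (y \in rangespace M).
Proof.
apply: (iffP memv_imgP) => [[x _ ->]|[x ->]]; exists x; rewrite ?memvf ?lfunE//.
Qed.

Lemma range_restrE n (M : 'M[F]_n) u : vsval (range_restr M u) = M *m vsval u.
Proof.
rewrite /range_restr.
have -> : linfun (fun u => vsproj (rangespace M) (mxlfun M (vsval u))) =
  (linfun (vsproj (rangespace M)) \o mxlfun M \o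
   linfun (@vsval _ _ (rangespace M)))%VF.
  apply/lfunP => v; rewrite !comp_lfunE /= !lfunE /=.
  have -> : (fun u => vsproj (rangespace M) (mxlfun M (vsval u))) =
    (vsproj (rangespace M) \o (mxlfun M \o @vsval _ _ (rangespace M))) by [].
  by rewrite lfunE /= lfunE.
rewrite !comp_lfunE /= !lfunE /= vsprojK //.
by apply/mem_rangespace; exists (vsval u).
Qed.

Lemma det_plus0 n : det_plus (0 : 'M[F]_n) = 1.
Proof.
rewrite /det_plus /lfun_det.
move: (range_restr _); rewrite /rangespace.
have -> : mxlfun (0 : 'M[F]_n) = 0.
  by apply/lfunP => x; rewrite !lfunE /= mul0mx.
rewrite lim0g => f.
have d0 : \dim {:subvs_of (0 : {vspace 'cV[F]_n})} = 0%N.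
  by rewrite dimvf /dim /= dimv0.
move: (mxof _ _ f); rewrite d0 => N.
by rewrite det_mx00.
Qed.

Lemma maximal_rankP k l (A : 'M[F]_k) B B' (C : 'M[F]_l) :
  maximal_rank (block_mx A B B' C) <->
  forall (x : 'cV[F]_k) (y : 'cV[F]_l),
    block_mx A B B' C *m col_mx x y = 0 <-> A *m x = 0 /\ C *m y = 0.
Proof.
rewrite /maximal_rank block_mxKul block_mxKdr.
have E (x : 'cV[F]_k) (y : 'cV[F]_l) : (col_mx x y \in
   (mxlfun (col_mx 1%:M 0) @: nullspace A
     + mxlfun (col_mx 0 1%:M) @: nullspace C)%VS) <-> A *m x = 0 /\ C *m y = 0.
  split=> [/memv_addP [u /memv_imgP[a aA ->] [v /memv_imgP[c cC ->]]]|[Ax Cy]].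
    rewrite !lfunE /= !mul_col_mx !mul1mx !mul0mx add_col_mx addr0 add0r.
    move=> /eq_col_mx [-> ->].
    by move: aA cC; rewrite !mem_nullspace => /eqP-> /eqP->.
  apply/memv_addP; exists (col_mx x 0); last exists (col_mx 0 y).
  - apply/memv_imgP; exists x; first by rewrite mem_nullspace Ax.
    by rewrite lfunE /= mul_col_mx mul1mx mul0mx.
  - apply/memv_imgP; exists y; first by rewrite mem_nullspace Cy.
    by rewrite lfunE /= mul_col_mx mul1mx mul0mx.
  - by rewrite add_col_mx addr0 add0r.
split=> [NH x y|h].
  by rewrite -E -NH mem_nullspace; split=> [->|/eqP].
apply/vspaceP => z; rewrite -[z]vsubmxK mem_nullspace.
by apply/eqP/idP => [/h/E|/E/h].
Qed.

End LinearMaps.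

Definition psd (C : numClosedFieldType) n (M : 'M[C]_n) : Prop :=
  M \is hermsymmx /\ forall x : 'cV[C]_n, 0 <= (x ^t* *m M *m x) 0 0.

(* Main.v *)
Require Import Defs.
From mathcomp Require Import all_boot all_order all_algebra.

(** Write H for the block matrix with diagonal blocks A, C and upper right
    block B.  On invertible matrices det_+ is det, and the claim is Fischer's
    inequality with its equality case; maximal rank is exactly what reduces the
    general case to that one.

    Compression.  Let U be a matrix with orthonormal rows and the same kernel
    as the Hermitian matrix M.  Its rows span the row space of M, so U^* is an
    orthonormal basis of R(M), and M restricted to R(M) has matrix U M U^* in
    this basis: det_+ M = det (U M U^* ) ([det_plus_compression]), and U M U^*
    is invertible.  Choose such a U for A and such a V for C.  Since the kernel
    of H is the direct sum of those of A and C, the matrix diag(U, V) serves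
    for H.  The compression of H is then an invertible positive semidefinite
    matrix with diagonal blocks U A U^*, V C V^* and off-diagonal block
    U B V^*, and that block vanishes exactly when B does, because
    H = W^* (W H W^* ) W for W = diag(U, V).

    Fischer's inequality ([fischer]).  For invertible H put Z = A^-1 B and
    S = Z^* A Z = B^* A^-1 B.  Then det H = det A * det T, where T = C - S is
    the Schur complement, and T is positive definite while S is positive
    semidefinite.  So it remains to compare det T with det C = det (T + S).
    With T = X^* X the quotient det (T + S) / det T is the determinant of
    1 + (X^-1)^* S X^-1, a product of factors 1 + d_i with d_i >= 0: it is at
    least 1, and equals 1 only if S = 0 ([det_psdD]).  Finally S = Z^* A Z = 0
    forces Z = 0, hence B = A Z = 0. *)

Set Implicit Arguments.
Unset Strict Implicit.
Unset Printing Implicit Defensive.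

Import Order.TTheory GRing.Theory Num.Theory passmx.
Local Open Scope ring_scope.
Local Open Scope sesquilinear_scope.

(** * Generalized determinant in a basis of the range *)

Lemma col_mulmx (K : pzSemiRingType) m n p (M : 'M[K]_(m, n))
    (N : 'M[K]_(n, p)) j : col j (M *m N) = M *m col j N.
Proof. by rewrite !colE mulmxA. Qed.

(** The dimensions d and r are equal as a consequence of the hypotheses; keeping
    them apart avoids a cast when one of them is the dimension of an abstract
    space. *)
Lemma det_similar (F : fieldType) d r (N : 'M[F]_d) (N' : 'M[F]_r)
    (E : 'M[F]_(d, r)) (E' : 'M[F]_(r, d)) :
  E *m E' = 1%:M -> E' *m E = 1%:M -> N *m E = E *m N' -> \det N = \det N'.
Proof.
move=> EE' E'E NE; have dr : d = r.
  by apply/eqP; rewrite eqn_leq (mulmx1_min EE') (mulmx1_min E'E).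
subst r; have -> : N = E *m N' *m E' by rewrite -NE -mulmxA EE' mulmx1.
by rewrite !det_mulmx mulrC mulrA -det_mulmx E'E det1 mul1r.
Qed.

(** The columns of P form a basis of R(M), and Q is a left inverse of P that
    reads off coordinates in this basis; hence Q M P is the matrix of M
    restricted to R(M). *)
Lemma det_plus_range_basis (F : fieldType) n r (M : 'M[F]_n) (P : 'M[F]_(n, r))
    (Q : 'M[F]_(r, n)) (K : 'M[F]_(n, r)) :
  Q *m P = 1%:M -> P *m (Q *m M) = M -> P = M *m K ->
  det_plus M = \det (Q *m M *m P).
Proof.
move=> QP PQM PMK; rewrite /det_plus /lfun_det.
set V := rangespace M; set b := vbasis _; set f := range_restr M.
have bV : basis_of {:subvs_of V} b := vbasisP _.
(* The rows of D are the transposed vectors of the basis used by [lfun_det]: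
   everything is transposed because [mxof] acts on row vectors. *)
pose D := \matrix_(i < \dim {:subvs_of V}) (vsval b`_i)^T.
have DE u : u *m D = (vsval (vecof b u))^T.
  rewrite mulmx_sum_row /vecof !linear_sum /=; apply: eq_bigr => i _.
  by rewrite rowK !linearZ.
have Dfree : row_free D.
  rewrite -kermx_eq0; apply/eqP/row_matrixP => i; rewrite row0.
  have /sub_kermxP := row_sub i (kermx D); rewrite DE -trmx0 => /trmx_inj v0.
  by apply/eqP; rewrite -(vecof_eq0 bV); apply/eqP/val_inj.
have DM : D *m M^T = mxof b b f *m D.
  apply/row_matrixP => i; rewrite !row_mul DE rowK rowE -hom_vecof //.
  by rewrite vecof_delta range_restrE trmx_mul.
have DPQ : D *m Q^T *m P^T = D.
  apply/row_matrixP => i; rewrite !row_mul rowK -!trmx_mul; congr (_^T).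
  by have /mem_rangespace[x ->] := subvsP b`_i; rewrite mulmxA -{2}PQM !mulmxA.
(* The coordinates of the columns of P in the basis D. *)
pose E' := \matrix_(j < r) rVof b (vsproj V (col j P)).
have E'D : E' *m D = P^T.
  apply/row_matrixP => j; rewrite row_mul rowK DE rVofK // vsprojK ?tr_col //.
  by apply/mem_rangespace; exists (col j K); rewrite -col_mulmx -PMK.
rewrite -[RHS]det_tr; apply: (@det_similar _ _ _ _ _ (D *m Q^T) E').
- apply: (row_free_inj Dfree); rewrite mul1mx -mulmxA E'D //.
- by rewrite mulmxA E'D -trmx_mul QP trmx1.
- by rewrite mulmxA -DM !trmx_mul !mulmxA DPQ.
Qed.

Section Hermitian.
Variable C : numClosedFieldType.

(** * Positive semidefinite matrices *)

Lemma adjmxM m n p (M : 'M[C]_(m, n)) (N : 'M[C]_(n, p)) :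
  (M *m N)^t* = N^t* *m M^t*.
Proof. by rewrite trmx_mul map_mxM. Qed.

Lemma hermsymmxP n (M : 'M[C]_n) : reflect (M^t* = M) (M \is hermsymmx).
Proof.
by apply: (iffP (sesquiP _ _ _)); rewrite expr0 scale1r => /esym.
Qed.

Lemma gram_diag_eq0 m n (X : 'M[C]_(m, n)) :
  (forall i, (X^t* *m X) i i = 0) -> X = 0.
Proof.
move=> X0; apply/matrixP => j i; rewrite mxE.
have /eqP := X0 i; rewrite mxE psumr_eq0 => [/allP/(_ j)|k _]; last first.
  by rewrite !mxE mulrC; exact: mul_conjC_ge0.
by rewrite !mxE mulrC mul_conjC_eq0 mem_index_enum => /(_ isT)/eqP.
Qed.

Lemma mulmx_inj_unitmx n (M : 'M[C]_n) :
  (forall x : 'cV_n, M *m x = 0 -> x = 0) -> M \in unitmx.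
Proof.
move=> Minj; rewrite -row_full_unit -cokermx_eq0; apply/eqP.
apply/matrixP => i j.
have := Minj (col j (cokermx M)); rewrite -col_mulmx mulmx_coker col0.
by move=> /(_ erefl)/matrixP/(_ i 0); rewrite !mxE.
Qed.

Lemma psd_congr m n (M : 'M[C]_m) (X : 'M[C]_(m, n)) :
  psd M -> psd (X^t* *m M *m X).
Proof.
move=> [/hermsymmxP Mh Mp]; split=> [|x].
  by apply/hermsymmxP; rewrite !adjmxM trmxCK Mh mulmxA.
by have := Mp (X *m x); rewrite adjmxM !mulmxA.
Qed.

Lemma psd_diag_ge0 n (M : 'M[C]_n) i : psd M -> 0 <= M i i.
Proof.
case=> _ /(_ (delta_mx i 0)).
have -> : (delta_mx i 0 : 'cV[C]_n)^t* = delta_mx 0 i.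
  by rewrite trmx_delta map_delta_mx.
by rewrite -rowE -colE !mxE.
Qed.

Lemma psd_spectral n (M : 'M[C]_n) : psd M ->
  exists (U : 'M[C]_n) (d : 'rV[C]_n),
    [/\ U \is unitarymx, forall i, 0 <= d 0 i & M = U^t* *m diag_mx d *m U].
Proof.
move=> pM; have [/hermitian_normalmx/orthomx_spectralP ME _] := pM.
have U1 := spectral_unitarymx M; rewrite invmx_unitary // in ME.
exists (spectralmx M), (spectral_diag M); split=> // i.
have := psd_diag_ge0 i (psd_congr ((spectralmx M)^t*) pM).
rewrite trmxCK {2}ME -!mulmxA (unitarymxP U1) mulmx1.
by rewrite mulmxA (unitarymxP U1) mul1mx mxE eqxx.
Qed.

(** The factor is X = sqrt(d) U for a spectral decomposition M = U^* d U. *)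
Lemma psd_gram n (M : 'M[C]_n) : psd M -> exists X : 'M[C]_n, M = X^t* *m X.
Proof.
move=> /psd_spectral[U [d [_ d0 ->]]].
exists (diag_mx (map_mx sqrtC d) *m U).
rewrite adjmxM !mulmxA; congr (_ *m _); rewrite -mulmxA; congr (_ *m _).
rewrite tr_diag_mx map_diag_mx mulmx_diag; congr diag_mx; apply/rowP => i.
by rewrite !mxE /= geC0_conj ?sqrtC_ge0 // -expr2 sqrtCK.
Qed.

(** If M = X^* X, then x^* M x is the squared norm of X x. *)
Lemma psd_kernel n (M : 'M[C]_n) (x : 'cV[C]_n) :
  psd M -> (x^t* *m M *m x) 0 0 = 0 -> M *m x = 0.
Proof.
move=> /psd_gram[X ->]; rewrite mulmxA -mulmxA -adjmxM => Xx0.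
suff Xx : X *m x = 0 by rewrite -mulmxA Xx mulmx0.
by apply: gram_diag_eq0 => i; rewrite ord1.
Qed.

Lemma psd_det_gt0 n (M : 'M[C]_n) : psd M -> M \in unitmx -> 0 < \det M.
Proof.
move=> pM; rewrite unitmxE unitfE lt_def => -> /=.
have [X ->] := psd_gram pM.
by rewrite det_mulmx det_map_mx det_tr mulrC mul_conjC_ge0.
Qed.

(** * Fischer's inequality *)

Lemma prod1D_ge1 (I : finType) (P : pred I) (d : I -> C) :
  (forall i, 0 <= d i) -> 1 <= \prod_(i | P i) (1 + d i).
Proof.
move=> d0; elim/big_ind: _ => // [x y x1 y1|i _]; last by rewrite lerDl.
by rewrite mulr_ege1.
Qed.

(** In an eigenbasis of S the determinant is a product of factors 1 + d_i >= 1;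
    when the product is 1 each factor is 1, the others being at least 1. *)
Lemma det_1D_psd n (S : 'M[C]_n) : psd S ->
  1 <= \det (1%:M + S) /\ (\det (1%:M + S) = 1 -> S = 0).
Proof.
move=> /psd_spectral[U [d [U1 d0 ->]]].
have -> : \det (1%:M + U^t* *m diag_mx d *m U) = \prod_i (1 + d 0 i).
  have -> : 1%:M + U^t* *m diag_mx d *m U =
            U^t* *m diag_mx (const_mx 1 + d) *m U.
    rewrite linearD /= diag_const_mx mulmxDr mulmxDl mulmx1 -invmx_unitary //.
    by rewrite mulVmx ?unitarymx_unit.
  rewrite !det_mulmx mulrAC -det_mulmx -invmx_unitary //.
  rewrite mulVmx ?unitarymx_unit // det1 mul1r det_diag.
  by apply: eq_bigr => i _; rewrite !mxE.
split=> [|det1]; first exact: prod1D_ge1.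
suff -> : d = 0 by rewrite linear0 mulmx0 mul0mx.
apply/rowP => i; rewrite mxE; apply/eqP; rewrite eq_le d0 andbT.
rewrite -(lerD2l 1) addr0 -[leRHS]det1 (bigD1 i) //=.
by rewrite ler_peMr ?prod1D_ge1 // addr_ge0.
Qed.

(** The congruence by X^-1, where T = X^* X, turns T into the identity and
    divides both determinants by det T. *)
Lemma det_psdD n (T S : 'M[C]_n) : psd T -> T \in unitmx -> psd S ->
  \det T <= \det (T + S) /\ (\det (T + S) = \det T -> S = 0).
Proof.
move=> pT uT pS; have [X TX] := psd_gram pT.
have [uX' uX] : X^t* \in unitmx /\ X \in unitmx.
  by apply/andP; rewrite -unitmx_mul -TX.
have SX : S = X^t* *m ((invmx X)^t* *m S *m invmx X) *m X.
  by rewrite !mulmxA -adjmxM mulVmx // mulmxKV // trmx1 map_mx1 mul1mx.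
have [] := det_1D_psd (psd_congr (invmx X) pS).
set S' := _ *m S *m _ in SX * => S1 S0.
have -> : \det (T + S) = \det T * \det (1%:M + S').
  rewrite SX TX -{1}[X^t*]mulmx1 -mulmxDl -mulmxDr !det_mulmx.
  by rewrite mulrAC.
have T0 := psd_det_gt0 pT uT.
split=> [|/eqP]; first by rewrite ler_peMr // ltW.
rewrite -subr_eq0 -{2}[\det T]mulr1 -mulrBr mulf_eq0 gt_eqF //= subr_eq0.
by move=> /eqP/S0 S'0; rewrite SX S'0 mulmx0 mul0mx.
Qed.

(** Block elimination gives det H = det A * det T for the Schur complement T of
    A, and D = T + S exceeds T by a positive semidefinite S that vanishes only
    with B. *)
Lemma fischer k l (A : 'M[C]_k) (B : 'M[C]_(k, l)) (D : 'M[C]_l) :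
  psd (block_mx A B (B^t*) D) -> block_mx A B (B^t*) D \in unitmx ->
  \det (block_mx A B (B^t*) D) <= \det A * \det D /\
  (\det (block_mx A B (B^t*) D) = \det A * \det D <-> B = 0).
Proof.
set H := block_mx A B (B^t*) D => pH uH.
have pA : psd A.
  have := psd_congr (col_mx 1%:M 0) pH.
  rewrite tr_col_mx map_row_mx trmx1 trmx0 map_mx1 map_mx0 mul_row_block.
  by rewrite mul_row_col !(mul1mx, mul0mx, mulmx1, mulmx0, addr0).
have uA : A \in unitmx.
  apply: mulmx_inj_unitmx => x Ax.
  have : H *m col_mx x 0 = 0.
    apply: psd_kernel => //.
    rewrite -mulmxA mul_block_col Ax !mulmx0 addr0 addr0.
    rewrite tr_col_mx map_row_mx trmx0 map_mx0 mul_row_col.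
    by rewrite mulmx0 mul0mx addr0 mxE.
  move=> /(congr1 (mulmx (invmx H))); rewrite mulKmx // mulmx0 -col_mx0.
  by move=> /eq_col_mx[].
(* With B = A Z the Schur complement needs no inverse: B^* A^-1 B = Z^* A Z. *)
pose Z := invmx A *m B; have BZ : B = A *m Z by rewrite mulKVmx.
have Ah : A^t* = A by apply/hermsymmxP; case: pA.
have BZt : B^t* = Z^t* *m A by rewrite BZ adjmxM Ah.
pose S := Z^t* *m A *m Z; pose T := D - S.
have pS : psd S := psd_congr Z pA.
have pT : psd T.
  (* T is the restriction of the form H to the vectors (- Z y, y). *)
  have := psd_congr (col_mx (- Z) 1%:M) pH.
  rewrite tr_col_mx map_row_mx linearN /= map_mxN trmx1 map_mx1.
  rewrite mul_row_block !mul1mx !mulNmx BZt addNr mul_row_col mul0mx add0r.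
  by rewrite mulmx1 addrC BZ mulmxA.
have HT : \det H = \det A * \det T.
  have -> : H = block_mx 1%:M 0 (Z^t*) 1%:M *m block_mx A B 0 T.
    rewrite mulmx_block !(mul1mx, mul0mx, mulmx0, addr0, add0r) -BZt.
    by rewrite /H; congr block_mx; rewrite addrC BZ mulmxA subrK.
  by rewrite det_mulmx det_lblock det_ublock !det1 !mul1r.
have uT : T \in unitmx.
  move: uH; rewrite !unitmxE !unitfE HT mulf_eq0 negb_or.
  by case/andP.
have A0 := psd_det_gt0 pA uA.
have [TD TDeq] := det_psdD pT uT pS; rewrite subrK in TD TDeq.
split; first by rewrite HT ler_pM2l.
split=> [|B0]; last by rewrite /H B0 det_lblock.
rewrite HT => /(mulfI (lt0r_neq0 A0))/esym/TDeq S0.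
suff Z0 : Z = 0 by rewrite BZ Z0 mulmx0.
(* S = (X Z)^* (X Z) for A = X^* X with X invertible. *)
have [X AX] := psd_gram pA.
have uX : X \in unitmx by move: uA; rewrite AX unitmx_mul => /andP[].
have XZ : X *m Z = 0.
  apply: gram_diag_eq0 => i.
  by rewrite adjmxM mulmxA -(mulmxA (Z^t*)) -AX -/S S0 mxE.
by rewrite -(mulKmx uX Z) XZ mulmx0.
Qed.

(** * Compression to the range *)

(** Gram-Schmidt applied to a basis of the row space of M: matrices with the
    same row space have the same kernel. *)
Lemma kernel_coisometry n (M : 'M[C]_n) :
  exists (r : nat) (U : 'M[C]_(r, n)), U \is unitarymx /\
    forall x : 'cV[C]_n, M *m x = 0 <-> U *m x = 0.
Proof.
exists (\rank M), (schmidt (row_base M)).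
split=> [|x]; first by rewrite schmidt_unitarymx ?rank_leq_col.
have UM : (schmidt (row_base M) :=: M)%MS.
  exact: eqmx_trans (eqmx_schmidt_free (row_base_free M)) (eq_row_base M).
have /submxP[K ME] : (M <= schmidt (row_base M))%MS by rewrite UM.
have /submxP[L UE] : (schmidt (row_base M) <= M)%MS by rewrite UM.
split=> x0; first by rewrite UE -mulmxA x0 mulmx0.
by rewrite ME -mulmxA x0 mulmx0.
Qed.

Section Compression.
Variables (r n : nat) (M : 'M[C]_n) (U : 'M[C]_(r, n)).
Hypotheses (Mh : M \is hermsymmx) (U1 : U \is unitarymx).
Hypothesis (kerMU : forall x : 'cV[C]_n, M *m x = 0 <-> U *m x = 0).

Let kerMUm p (X : 'M[C]_(n, p)) : M *m X = 0 <-> U *m X = 0.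
Proof.
split=> X0; apply/matrixP => i j.
  have /kerMU : M *m col j X = 0 by rewrite -col_mulmx X0 col0.
  by rewrite -col_mulmx => /matrixP/(_ i 0); rewrite !mxE.
have /kerMU : U *m col j X = 0 by rewrite -col_mulmx X0 col0.
by rewrite -col_mulmx => /matrixP/(_ i 0); rewrite !mxE.
Qed.

(** As U U^* = 1, U kills 1 - U^* U, and so does M. *)
Lemma mulmx_projr : M *m U^t* *m U = M.
Proof.
apply/eqP; rewrite -mulmxA -subr_eq0 -{2}[M]mulmx1 -mulmxBr.
apply/eqP/kerMUm; rewrite mulmxBr mulmx1 mulmxA.
by rewrite (unitarymxP U1) mul1mx subrr.
Qed.

Lemma mulmx_projl : U^t* *m (U *m M) = M.
Proof.
have /hermsymmxP Ma := Mh.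
by rewrite -{2}Ma -{2}mulmx_projr !adjmxM trmxCK Ma.
Qed.

(** The columns of U^* form a basis of R(M): the rows of U lie in the row space
    of M since U kills the kernel of M, and M is Hermitian. *)
Lemma det_plus_compression : det_plus M = \det (U *m M *m U^t*).
Proof.
have /submxP[K UE] : (U <= M)%MS.
  by rewrite submxE; apply/eqP/kerMUm; rewrite mulmx_coker.
apply: (@det_plus_range_basis _ _ _ _ _ _ (K^t*)).
- exact/unitarymxP.
- exact: mulmx_projl.
- by have /hermsymmxP Ma := Mh; rewrite {1}UE adjmxM Ma.
Qed.

(** M U^* x = 0 implies U U^* x = 0 by equality of kernels, and U U^* = 1. *)
Lemma compression_unitmx : U *m M *m U^t* \in unitmx.
Proof.
apply: mulmx_inj_unitmx => x /(congr1 (mulmx (U^t*))).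
rewrite mulmx0 !mulmxA -(mulmxA _ U M) mulmx_projl -mulmxA => /kerMU.
by rewrite mulmxA (unitarymxP U1) mul1mx.
Qed.

End Compression.

(** * Fischer's inequality for the generalized determinant *)

(** Maximal rank makes diag(U, V) a coisometry with the kernel of H whenever U
    and V are coisometries with the kernels of A and D; compressing by these
    turns the claim into Fischer's inequality for invertible matrices. *)
Theorem det_plus_fischer k l (A : 'M[C]_k) (B : 'M[C]_(k, l)) (D : 'M[C]_l) :
  psd (block_mx A B (B^t*) D) -> maximal_rank (block_mx A B (B^t*) D) ->
  det_plus (block_mx A B (B^t*) D) <= det_plus A * det_plus D /\
  (det_plus (block_mx A B (B^t*) D) = det_plus A * det_plus D <-> B = 0).
Proof.
move=> Hpsd Hmax.
have [r [U [U1 kerU]]] := kernel_coisometry A.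
have [s [V [V1 kerV]]] := kernel_coisometry D.
set H := block_mx A B (B^t*) D in Hpsd Hmax *.
have [Hh _] := Hpsd.
pose W := block_mx U 0 0 V.
have Wt : W^t* = block_mx (U^t*) 0 0 (V^t*).
  by rewrite tr_block_mx map_block_mx !trmx0 !map_mx0.
have W1 : W \is unitarymx.
  apply/unitarymxP; rewrite Wt mulmx_block !mulmx0 !mul0mx !addr0 !add0r.
  by rewrite (unitarymxP U1) (unitarymxP V1) -scalar_mx_block.
have kerW (x : 'cV[C]_(k + l)) : H *m x = 0 <-> W *m x = 0.
  rewrite -[x]vsubmxK.
  have /maximal_rankP kerH := Hmax.
  rewrite kerH kerU kerV mul_block_col !mul0mx addr0 add0r -col_mx0.
  by split=> [[-> ->]|/eq_col_mx].
have [Ah Dh] : A \is hermsymmx /\ D \is hermsymmx.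
  have /hermsymmxP := Hh; rewrite tr_block_mx map_block_mx.
  by move=> /eq_block_mx[? _ _ ?]; split; apply/hermsymmxP.
have HW : W *m H *m W^t* = block_mx (U *m A *m U^t*) (U *m B *m V^t*)
    ((U *m B *m V^t*)^t*) (V *m D *m V^t*).
  rewrite Wt !mulmx_block !(mulmx0, mul0mx, addr0, add0r).
  by rewrite !adjmxM trmxCK !mulmxA.
rewrite (det_plus_compression Hh W1 kerW) (det_plus_compression Ah U1 kerU).
rewrite (det_plus_compression Dh V1 kerV).
have pW : psd (W *m H *m W^t*).
  by have := psd_congr (W^t*) Hpsd; rewrite trmxCK.
have uW := compression_unitmx Hh W1 kerW.
move: pW uW; rewrite HW => pW uW; have [le_det eq_det] := fischer pW uW.
split=> //; apply: iff_trans eq_det _.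
split=> [UBV|->]; last by rewrite mulmx0 mul0mx.
(* H = W^* (W H W^* ) W, and the off-diagonal blocks of W H W^* vanish. *)
have HE : H = W^t* *m (W *m H *m W^t*) *m W.
  by rewrite !mulmxA -(mulmxA _ W H) mulmx_projl // mulmx_projr.
move: HE; rewrite HW UBV trmx0 map_mx0 Wt !mulmx_block.
by rewrite !(mulmx0, mul0mx, addr0, add0r) => /eq_block_mx[].
Qed.

End Hermitian.

Theorem proposition4p1 (R : realType) (k l : nat) (hk : (1 <= k)%N)
    (hl : (1 <= l)%N) (A : 'M[R[i]]_k) (B : 'M[R[i]]_(k, l)) (C : 'M[R[i]]_l)
    (Hpsd : psd (block_mx A B (B ^t*) C))
    (Hmax : maximal_rank (block_mx A B (B ^t*) C)) :
  det_plus (block_mx A B (B ^t*) C) <= det_plus A * det_plus C /\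
  (det_plus (block_mx A B (B ^t*) C) = det_plus A * det_plus C <-> B = 0).
Proof. exact: det_plus_fischer. Qed.
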